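(* Let $k\geq 4$ be an integer. There exists $n_0=n_0(k)$ such that for every $n\geq n_0$, every graph $G$ of order $n$ with $\mu(G)\geq\mu(S_{n,k})$ contains both $T_4$ and $T_5$ as subgraphs.
   Context: $\mu(G)$ denotes the spectral radius of the adjacency matrix of $G$. $S_{n,k}=K_k\vee\overline{K_{n-k}}$. $T_4$ is the tree of order $2k+3$ consisting of a root $r$ adjacent to $k$ vertices $v_1,\ldots,v_k$, where $v_1$ and $v_2$ each have exactly two further leaf neighbours and each of $v_3,\ldots,v_k$ has exactly one further leaf neighbour. $T_5$ is the tree of order $2k+3$ consisting of a root $r$ adjacent to $k$ vertices $v_1,\ldots,v_k$, where $v_1$ has exactly three further leaf neighbours and each of $v_2,\ldots,v_k$ has exactly one further leaf neighbour. *)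

(* Defs.v *)
From mathcomp Require Import all_boot all_order all_algebra.
From mathcomp Require Import classical_sets reals.
From mathcomp Require Import complex.

Set Implicit Arguments.
Unset Strict Implicit.
Unset Printing Implicit Defensive.

Import Order.TTheory GRing.Theory Num.Theory.

Local Open Scope ring_scope.
Local Open Scope complex_scope.

Record sgraph := SGraph {
  vertex :> finType;
  adj : rel vertex;
  adj_sym : symmetric adj;
  adj_irrefl : irreflexive adj }.

Arguments adj {s} : rename.

(* A subgraph copy need not be induced. *)
Definition has_subgraph (H G : sgraph) : Prop :=
  exists2 f : H -> G, injective f & forall u v : H, adj u v -> adj (f u) (f v).

(* [enum_val] fixes an arbitrary ordering of the vertices; the eigenvalues do
   not depend on it. *)
Definition adjmx (R : pzRingType) (G : sgraph) : 'M[R]_#|G| :=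
  \matrix_(i, j) (adj (enum_val i) (enum_val j))%:R.

(* Largest modulus of a complex eigenvalue; on the order-0 graph this is
   [sup set0 = 0]. *)
Definition spectral_radius (R : realType) (G : sgraph) : R :=
  sup [set complex.Re `|a| |
         a in [set a : R[i] | eigenvalue (adjmx R[i] G) a]]%classic.

Section Complete.
Variable T : finType.
Let e : rel T := fun u v => u != v.
Fact complete_sym : symmetric e. Proof. by move=> u v; rewrite /e eq_sym. Qed.
Fact complete_irrefl : irreflexive e. Proof. by move=> u; rewrite /e eqxx. Qed.
Definition complete_graph : sgraph := SGraph complete_sym complete_irrefl.
End Complete.

Section Complement.
Variable G : sgraph.
Let e : rel G := fun u v => (u != v) && ~~ adj u v.
Fact compl_sym : symmetric e.
Proof. by move=> u v; rewrite /e eq_sym adj_sym. Qed.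
Fact compl_irrefl : irreflexive e. Proof. by move=> u; rewrite /e eqxx. Qed.
Definition compl_graph : sgraph := SGraph compl_sym compl_irrefl.
End Complement.

Section Join.
Variables G H : sgraph.
Let e : rel (G + H)%type := fun x y =>
  match x, y with
  | inl u, inl v => adj u v
  | inr u, inr v => adj u v
  | _, _ => true
  end.
Fact join_sym : symmetric e.
Proof. by move=> [u|u] [v|v] //=; exact: adj_sym. Qed.
Fact join_irrefl : irreflexive e.
Proof. by move=> [u|u] /=; exact: adj_irrefl. Qed.
Definition join_graph : sgraph := SGraph join_sym join_irrefl.
End Join.

Definition K_graph (n : nat) : sgraph := complete_graph 'I_n.

(* [n - k] is truncated, so this is the intended graph only for [k <= n]. *)
Definition S_graph (n k : nat) : sgraph :=
  join_graph (K_graph k) (compl_graph (K_graph (n - k)%N)).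

(* The rooted tree of depth at most two whose root [Root] has [k] children
   [Child i], the [i]-th of which has [c i] leaf neighbours [Leaf i j]. *)
Section DepthTwoTree.
Variables (k : nat) (c : 'I_k -> nat).

Definition tree_vertex : finType :=
  (unit + ('I_k + {i : 'I_k & 'I_(c i)}))%type.

Definition Root : tree_vertex := inl tt.
Definition Child (i : 'I_k) : tree_vertex := inr (inl i).
Definition Leaf (i : 'I_k) (j : 'I_(c i)) : tree_vertex :=
  inr (inr (Tagged (fun i => 'I_(c i)) j)).

Definition parent_of (x y : tree_vertex) : bool :=
  match x, y with
  | inl _, inr (inl _) => true
  | inr (inl i), inr (inr l) => tag l == i
  | _, _ => false
  end.

Let e : rel tree_vertex := fun x y => parent_of x y || parent_of y x.
Fact tree_sym : symmetric e. Proof. by move=> x y; rewrite /e orbC. Qed.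
Fact tree_irrefl : irreflexive e. Proof. by move=> [?|[?|?]]. Qed.
Definition depth_two_tree : sgraph := SGraph tree_sym tree_irrefl.
End DepthTwoTree.

(* [v_1], [v_2], ... are [Child 0], [Child 1], ... *)
Definition T4 (k : nat) : sgraph :=
  depth_two_tree (fun i : 'I_k => if (i < 2)%N then 2%N else 1%N).
Definition T5 (k : nat) : sgraph :=
  depth_two_tree (fun i : 'I_k => if (i < 1)%N then 3%N else 1%N).

(* Main.v *)
(** Let D be the order of the tree.  If some vertex r has k neighbours of degree
    at least D, the tree embeds greedily with its root at r.  Otherwise every
    vertex has at most k - 1 neighbours of degree at least D.  Weight these
    high-degree vertices by s, where (k - 1) s^2 = n, and all others by 1; the
    adjacency operator multiplies this weight by at most (k - 1) s + D, which
    therefore bounds the spectral radius by sqrt ((k - 1) n) + O(1).  This is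
    less than sqrt (k (n - k)), a lower bound for mu(S_{n,k}), once n is large. *)

Require Import Defs.
From mathcomp Require Import all_boot all_order all_algebra.
From mathcomp Require Import classical_sets reals.
From mathcomp Require Import complex zify ring lra.

Import Order.TTheory GRing.Theory Num.Theory.

Local Open Scope ring_scope.

(* Compare at an index maximising [`|z i| / y i], for an eigenvector [z]. *)
Lemma weighted_eigenvalue_bound (F : numFieldType) (n : nat) (A : 'M[F]_n)
    (y : 'I_n -> F) (lam a : F) :
  (forall i, 0 < y i) ->
  (forall j, \sum_i `|A i j| * y i <= lam * y j) ->
  eigenvalue A a -> `|a| <= lam.
Proof.
move=> y_gt0 Ay /eigenvalueP[z zA /rV0Pn[i0 zi0]].
pose q i := `|z 0 i| / y i.
(* The order on [F], later [R[i]], is only partial; a maximum exists because the quotients are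
   real. *)
have q_real : {in predT, forall i, q i \is Num.real}.
  by move=> i _; rewrite ger0_real // divr_ge0 // ltW.
case: (real_arg_maxP (erefl : predT i0) q_real) => j _ q_le.
have zE i : `|z 0 i| = q i * y i by rewrite /q divfK // gt_eqF.
have qj_gt0 : 0 < q j.
  by apply: lt_le_trans (q_le i0 isT); rewrite divr_gt0 // normr_gt0.
(* With [z 0 i] of modulus [q i * y i], the maximality [q i <= q j] lets [q j] be pulled out of
   column [j] of [z *m A], and [Ay j] bounds what remains. *)
rewrite -(ler_pM2r (mulr_gt0 qj_gt0 (y_gt0 j))) -zE -normrM.
have -> : a * z 0 j = \sum_i z 0 i * A i j.
  by have /rowP/(_ j) := zA; rewrite !mxE => ->.
rewrite zE mulrCA; apply: le_trans (ler_norm_sum _ _ _) _.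
apply: le_trans (ler_wpM2l (ltW qj_gt0) (Ay j)); rewrite mulr_sumr.
apply: ler_sum => i _; rewrite normrM zE -mulrA (mulrC (y i)).
by apply: ler_wpM2r; [rewrite mulr_ge0 // ltW | exact: q_le].
Qed.

Lemma graph_eigenvalue_bound (R : realType) (G : sgraph) (y : G -> R) (lam : R)
    (a : R[i]) :
  (forall u, 0 < y u) -> (forall u, \sum_(v | adj u v) y v <= lam * y u) ->
  eigenvalue (adjmx R[i] G) a -> complex.Re `|a| <= lam.
Proof.
move=> y_gt0 Ay ev; rewrite -lecR RRe_real ?normr_real //.
apply: (weighted_eigenvalue_bound _ _ _ (fun i => (y (enum_val i))%:C%C)) ev.
  by move=> i; rewrite ltcR.
move=> j; rewrite -rmorphM; apply: (@le_trans _ _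
  (\sum_(v | adj (enum_val j) v) y v)%:C%C); last by rewrite lecR.
rewrite rmorph_sum [X in _ <= X]big_mkcond/= (reindex _ (onW_bij _ (enum_val_bij G)))/=.
apply: ler_sum => i _; rewrite mxE adj_sym.
by case: ifP => _; rewrite ?normr1 ?normr0 ?mul1r ?mul0r.
Qed.

Lemma spectral_radius_le (R : realType) (G : sgraph) (y : G -> R) (lam : R) :
  0 <= lam -> (forall u, 0 < y u) ->
  (forall u, \sum_(v | adj u v) y v <= lam * y u) ->
  spectral_radius R G <= lam.
Proof.
move=> lam_ge0 y_gt0 Ay; rewrite /spectral_radius.
(* If [E] is empty, the supremum is 0 by default, and [0 <= lam] settles that case. *)
set E := (X in sup X); have [->|E0] := eqVneq E set0; first by rewrite sup0.
apply: ge_sup; first exact/set0P.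
by move=> _ [a ev <-]; apply: graph_eigenvalue_bound ev.
Qed.

Lemma spectral_radius_ge (R : realType) (G : sgraph) (x : G -> R) (a : R) :
  0 <= a -> (exists u, x u != 0) ->
  (forall u, \sum_(v | adj u v) x v = a * x u) ->
  a <= spectral_radius R G.
Proof.
move=> a_ge0 [u0 xu0] Ax; apply: ub_le_sup.
  (* The supremum needs a bounded set: the constant weight 1 bounds every eigenvalue by the maximum
     degree. *)
  exists #|G|%:R => _ [b ev <-].
  apply: (graph_eigenvalue_bound _ _ (fun=> 1)) ev => // u.
  by rewrite mulr1 sumr_const ler_nat max_card.
have -> : a = complex.Re `|a%:C%C|.
  by rewrite ger0_norm // lecR.
exists (a%:C)%C => //=.
have -> : adjmx R[i] G = map_mx (real_complex R) (adjmx R G).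
  by apply/matrixP => i j; rewrite !mxE; case: (adj _ _).
rewrite eigenvalue_map; apply/eigenvalueP.
exists (\row_i x (enum_val i)).
  apply/rowP => j; rewrite !mxE -Ax [RHS]big_mkcond/=.
  rewrite [RHS](reindex _ (onW_bij _ (enum_val_bij G)))/=.
  apply: eq_bigr => i _; rewrite !mxE adj_sym.
  by case: ifP => _; rewrite ?mulr1 ?mulr0.
by apply/rV0Pn; exists (enum_rank u0); rewrite mxE enum_rankK.
Qed.

(** The partition into K_k and the independent set is equitable, so a weight constant on both parts
    reduces the eigenvalue equation to a^2 = (k - 1) a + k (n - k). Its larger root is at least sqrt
    (k (n - k)). *)
Lemma spectral_radius_S_ge (R : realType) (n k : nat) :
  (0 < k < n)%N ->
  Num.sqrt ((k * (n - k))%:R) <= spectral_radius R (S_graph n k).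
Proof.
case/andP=> k_gt0 k_lt_n; pose c : R := k.-1%:R / 2.
pose m : R := (k * (n - k))%:R; pose a := c + Num.sqrt (c ^+ 2 + m).
have c_ge0 : 0 <= c by rewrite divr_ge0.
have m_ge0 : 0 <= m by rewrite /m ler0n.
have a_ge : Num.sqrt m <= a.
  rewrite -[leLHS]add0r lerD // ler_sqrt ?lerDr ?sqr_ge0 //.
  by rewrite addr_ge0 ?sqr_ge0.
apply: le_trans a_ge _.
(* [a] is the Perron eigenvalue of S_{n,k}, with eigenvector [a] on K_k and [k]
   on the independent set. *)
have aE : a * a = k.-1%:R * a + k%:R * (n - k)%:R.
  have := @sqr_sqrtr _ (c ^+ 2 + m) (addr_ge0 (sqr_ge0 c) m_ge0).
  rewrite -natrM -/m -[k.-1%:R](@divfK _ 2) ?pnatr_eq0 // -/c /a.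
  by move: (Num.sqrt _) => s; rewrite !expr2 => sE; ring: sE.
pose x (v : S_graph n k) : R := if v is inl _ then a else k%:R.
apply: (@spectral_radius_ge R _ x).
- by rewrite addr_ge0 ?sqrtr_ge0.
- have n_k : (0 < n - k)%N by rewrite subn_gt0.
  by exists (inr (Ordinal n_k)); rewrite /= pnatr_eq0 -lt0n.
move=> [u|u]; rewrite big_sumType/= !sumr_const.
- rewrite card_ord (eq_card (_ : _ =i predC1 (u : 'I_k))).
    by rewrite cardC1 card_ord aE mulr_natr mulr_natl.
  by move=> i; rewrite !inE /in_mem /= eq_sym.
- rewrite card_ord eq_card0 ?mulr0n ?addr0 ?mulr_natr //.
  by move=> i; rewrite /in_mem /= andbN.
Qed.

(** Values are chosen one at a time: [F] and the earlier choices together exclude fewer than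
    [#|F| + #|I|] elements. In the embedding, [I] is the set of leaves, [N] gives the neighbourhood
    of the parent's image, and [F] holds the images of root and children. *)
Lemma greedy_injection (I T : finType) (t0 : T) (N : I -> {set T}) (F : {set T}) :
  (forall i, #|F| + #|I| <= #|N i|)%N ->
  exists g : I -> T, injective g /\ forall i, g i \in N i :\: F.
Proof.
move=> N_large.
suff [g g_inj gN] : exists2 g : I -> T, {in enum I &, injective g} &
    {in enum I, forall i, g i \in N i :\: F}.
  by exists g; split=> [i j|i]; [apply: g_inj | apply: gN]; rewrite mem_enum.
elim: (enum I) (enum_uniq I) => [|i s IHs] /=; first by exists (fun=> t0).
case/andP=> s'i s_uniq; have [g g_inj gN] := IHs s_uniq.
have [x] : exists x, x \in N i :\: (F :|: [set x in map g s]).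
  apply/card_gt0P; rewrite cardsD subn_gt0.
  apply: leq_trans (N_large i).
  apply: leq_ltn_trans (subset_leq_card (subsetIr _ _)) _.
  rewrite (leq_ltn_trans (leq_card_setU _ _)) // ltn_add2l cardsE.
  rewrite (leq_ltn_trans (card_size _)) // size_map -(card_uniqP s_uniq).
  apply: proper_card; apply/properP; split; first exact/subset_predT.
  by exists i.
rewrite !inE negb_or => /andP[/andP[xF xg] xN].
have neq_i j : j \in s -> (j == i) = false.
  by move=> sj; apply: contraNF s'i => /eqP <-.
exists (fun j => if j == i then x else g j) => [j l|j]; last first.
  rewrite inE; case: eqVneq => [->|_] /= sj; last exact: gN.
  by rewrite inE xF.
rewrite !inE; case: eqVneq => [->|_] /= sj; case: eqVneq => [->|_] //= sl.
- by move=> xE; rewrite xE map_f in xg.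
- by move=> xE; rewrite -xE map_f in xg.
- exact: g_inj.
Qed.

Definition high_neighbours (G : sgraph) (D : nat) (u : G) : {set G} :=
  [set v | adj u v & (D <= #|[set w | adj v w]|)%N].

(** The children go to high-degree neighbours of [r]. The set [F] has at most 1 + k elements, so
    [#|F|] plus the number of leaves is at most the order of the tree, which is the degree available
    at each child's image. *)
Lemma depth_two_tree_subgraph (G : sgraph) (k : nat) (c : 'I_k -> nat) (r : G) :
  (k <= #|high_neighbours G #|depth_two_tree c| r|)%N ->
  has_subgraph (depth_two_tree c) G.
Proof.
move=> k_le; pose v i := enum_val (widen_ord k_le i).
have v_inj : injective v by move=> i j /enum_val_inj/(congr1 val)/= /val_inj.
have /all_and2[rv v_high] i :
  adj r (v i) /\ (#|depth_two_tree c| <= #|[set w | adj (v i) w]|)%N.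
  by have := enum_valP (widen_ord k_le i); rewrite inE => /andP.
pose F := r |: [set v i | i : 'I_k].
have rF : r != v _ by move=> i; apply: contraTneq (rv i) => <-; rewrite adj_irrefl.
have FP i : v i \in F by rewrite !inE imset_f ?orbT.
have [|g [g_inj gN]] := @greedy_injection {i : 'I_k & 'I_(c i)} G r
  (fun l => [set w | adj (v (tag l)) w]) F.
  move=> l; apply: leq_trans (v_high _); rewrite !card_sum card_unit card_ord.
  rewrite addnA leq_add2r; rewrite (leq_trans (leq_card_setU _ _)) // cards1.
  by rewrite leq_add2l -[leqRHS]card_ord leq_imset_card.
have gF l : g l \notin F by have := gN l; rewrite inE => /andP[].
have vg l : adj (v (tag l)) (g l) by have := gN l; rewrite !inE => /andP[].
pose f (x : depth_two_tree c) : G := match x with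
  | inl _ => r | inr (inl i) => v i | inr (inr l) => g l end.
exists f.
  have rg l : r != g l by apply: contraNneq (gF l) => <-; rewrite !inE eqxx.
  have vg' i l : v i != g l by apply: contraNneq (gF l) => <-.
  move=> [[]|[i|l]] [[]|[j|m]] //= /eqP; rewrite ?(negPf (rF _))
    ?(negPf (rg _)) ?(negPf (vg' _ _)) // 1?eq_sym ?(negPf (rF _))
    ?(negPf (rg _)) ?(negPf (vg' _ _)) //.
  - by move=> /eqP/v_inj->.
  - by move=> /eqP/g_inj->.
have f_parent x y : parent_of x y -> adj (f x) (f y).
  by case: x y => [[]|[i|l]] [[]|[j|m]] //= /eqP <-.
by move=> x y /orP[/f_parent | /f_parent]; rewrite // adj_sym.
Qed.

Lemma spectral_radius_few_high_neighbours (R : realType) (G : sgraph) (k D : nat) :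
  (1 < k <= D)%N -> (k.-1 * (4 * D) ^ 2 <= #|G|)%N ->
  (forall u : G, #|high_neighbours G D u| < k)%N ->
  spectral_radius R G < Num.sqrt (k * (#|G| - k))%:R.
Proof.
case/andP=> k_gt1 kD G_large few.
pose p : R := k.-1%:R; pose d : R := D%:R; pose n : R := #|G|%:R.
have kE : k%:R = p + 1 :> R by rewrite natr1 prednK // ltnW.
have p_ge1 : 1 <= p by rewrite ler1n -ltnS prednK // ltnW.
have pd : p + 1 <= d by rewrite -kE ler_nat.
have n_large : p * (4 * d) ^+ 2 <= n.
  by rewrite /p /n /d -natrM -natrX -natrM ler_nat.
(* This choice makes n = p s^2, and the factor 4 in the size hypothesis becomes [4 * d <= s]. *)
pose s := Num.sqrt (n / p).
have s_ge : 4 * d <= s.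
  rewrite -[4 * d]ger0_norm -?sqrtr_sqr; last by nra.
  by rewrite ler_wsqrtr // ler_pdivlMr 1?mulrC //; lra.
have nE : n = p * s ^+ 2.
  by rewrite sqr_sqrtr ?divr_ge0 ?ler0n // mulrC divfK // gt_eqF //; lra.
have kG : (k <= #|G|)%N.
  apply: leq_trans (leq_trans kD _) G_large.
  by rewrite -[leqLHS]mul1n leq_mul //; [rewrite -ltnS prednK // ltnW | nia].
apply: (@le_lt_trans _ _ (p * s + d)).
  pose y (u : G) : R := if (D <= #|[set w | adj u w]|)%N then s else 1.
  apply: (@spectral_radius_le _ _ y) => [|u|u]; first by nra.
    by rewrite /y; case: ifP => _ //; lra.
  have few_le : #|[pred v | adj u v && (D <= #|[set w | adj v w]|)%N]|%:R <= p.
    have := few u; rewrite cardsE => few_u.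
    by rewrite ler_nat -ltnS prednK // ltnW.
  pose deg : R := #|[set w | adj u w]|%:R.
  have low_le : #|[pred v | adj u v && ~~ (D <= #|[set w | adj v w]|)%N]|%:R <= deg.
    rewrite ler_nat subset_leq_card //.
    by apply/fintype.subsetP => v; rewrite !inE => /andP[].
  have deg_n : deg <= n by rewrite ler_nat max_card.
  rewrite (bigID (fun v => D <= #|[set w | adj v w]|)%N)/=.
  rewrite (eq_bigr (fun=> s)) => [|v /andP[_ vD]]; last by rewrite /y vD.
  rewrite [X in _ + X](eq_bigr (fun=> 1)) => [|v /andP[_ /negPf vD]];
    last by rewrite /y vD.
  rewrite !sumr_const -[s *+ _]mulr_natl.
  move: few_le low_le; set a := _%:R; set b := _%:R => few_le low_le.
  have a_ge0 : 0 <= a by rewrite ler0n.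
  (* At a high-degree vertex, p s + n = p s + p s^2 <= (p s + d) s since p <= d; at any other
     vertex, at most d neighbours have weight 1. *)
  rewrite -[X in X * s]/a -[X in _ + X]/b /y; case: ifP => [_|/negbT].
    by nra.
  rewrite -ltnNge => /ltnW; rewrite -(ler_nat R) -/d -/deg => deg_d.
  by nra.
rewrite -[ltLHS]ger0_norm -?sqrtr_sqr; last by nra.
(* In [gap], right side minus left side is p s (s - 2 d) - d^2 - (p + 1)^2, which is at least 8 d^2
   - 2 d^2 > 0. *)
have s_sub : 8 * d ^+ 2 <= s * (s - 2 * d) by nra.
have ps_sub : s * (s - 2 * d) <= p * (s * (s - 2 * d)) by rewrite ler_peMl //; nra.
have p_sqr : (p + 1) ^+ 2 <= d ^+ 2 by rewrite ler_sqr ?nnegrE //; lra.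
have gap : (p * s + d) ^+ 2 < (p + 1) * (n - (p + 1)) by rewrite nE; nra.
rewrite natrM natrB // kE -/n ltr_sqrt //.
by apply: le_lt_trans gap; rewrite sqr_ge0.
Qed.

(** The leaf counts [c] enter the threshold only through the order of the tree, so one argument
    serves both [T4] and [T5]. *)
Lemma depth_two_tree_extremal (R : realType) (k : nat) (c : 'I_k -> nat) (G : sgraph) :
  (1 < k)%N -> (k.-1 * (4 * #|depth_two_tree c|) ^ 2 <= #|G|)%N ->
  spectral_radius R (S_graph #|G| k) <= spectral_radius R G ->
  has_subgraph (depth_two_tree c) G.
Proof.
move=> k_gt1 G_large muG; set D := #|depth_two_tree c| in G_large.
have kD : (k < D)%N by rewrite /D !card_sum card_unit card_ord add1n ltnS leq_addr.
case: (boolP [exists r : G, k <= #|high_neighbours G D r|]%N) => [/existsP[r]|].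
  exact: depth_two_tree_subgraph.
rewrite negb_exists => /forallP few; move: muG; rewrite leNgt => /negP[].
apply: lt_le_trans (spectral_radius_few_high_neighbours _ _ _ D _ G_large _) _.
- by rewrite k_gt1 ltnW.
- by move=> u; rewrite ltnNge few.
apply: spectral_radius_S_ge; rewrite ltnW //=.
apply: leq_trans (leq_trans kD _) G_large.
by rewrite -[leqLHS]mul1n leq_mul //; [rewrite -ltnS prednK // ltnW | nia].
Qed.

Theorem theorem4p1 (R : realType) (k : nat) (hk : (4 <= k)%N) :
  exists n0 : nat, forall n : nat, (n0 <= n)%N ->
    forall G : sgraph, #|G| = n ->
      spectral_radius R (S_graph n k) <= spectral_radius R G ->
      has_subgraph (T4 k) G /\ has_subgraph (T5 k) G.
Proof.
have k_gt1 : (1 < k)%N by apply: leq_trans hk.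
pose n0 (H : sgraph) := (k.-1 * (4 * #|H|) ^ 2)%N.
exists (maxn (n0 (T4 k)) (n0 (T5 k))) => _ /[swap] G /[swap] <-.
rewrite geq_max => /andP[G4 G5] muG.
by split; apply: depth_two_tree_extremal muG.
Qed.
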